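(* Let $a$ and $b$ be positive integers. Then there exists a connected graph $G$ such that $src(G)=a$ and $src^\ell(G)=b$ if and only if $a=b=1$ or $2\le a\le b$.
   Context: All graphs are finite, simple and undirected. An edge-coloured path is rainbow if all its edges have distinct colours; a geodesic is a shortest path between its endpoints. An (not necessarily proper) edge-colouring of a connected graph $G$ is strongly rainbow connected if any two vertices are joined by a rainbow geodesic; $src(G)$ is the minimum number of colours in such a colouring. An $r$-edge-list assignment of $G$ assigns to each edge $e$ a set $L(e)\subset\mathbb N$ with $|L(e)|\ge r$; an $L$-edge-colouring is an edge-colouring $c$ with $c(e)\in L(e)$ for all $e$. $src^\ell(G)$ is the minimum integer $r$ such that for every $r$-edge-list assignment $L$ of $G$ there exists a strongly rainbow connected $L$-edge-colouring of $G$. *)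

(* Defs.v *)
From mathcomp Require Import all_boot.
From mathcomp Require Import boolp classical_sets functions cardinality.

Set Implicit Arguments.
Unset Strict Implicit.
Unset Printing Implicit Defensive.

Record sgraph := SGraph {
  vertex :> finType;
  adj : rel vertex;
  adj_sym : symmetric adj;
  adj_irr : irreflexive adj
}.

Definition edges (G : sgraph) : {set {set G}} :=
  ([set [set p.1; p.2] | p : G * G & adj p.1 p.2])%SET.

Definition connected_graph (G : sgraph) : Prop :=
  0 < #|G| /\ forall x y : G, connect (@adj G) x y.

(* As in path.v, the path x = v_0, v_1, ..., v_k = y is given by its start x
   and the sequence p = [:: v_1; ...; v_k], so that its length is size p. *)
Definition is_path (G : sgraph) (x y : G) (p : seq G) : bool :=
  [&& path (@adj G) x p, last x p == y & uniq (x :: p)].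

Definition geodesic (G : sgraph) (x y : G) (p : seq G) : Prop :=
  is_path x y p /\ forall q : seq G, is_path x y q -> size p <= size q.

Definition path_edges (G : sgraph) (x : G) (p : seq G) : seq {set G} :=
  pairmap (fun u v : G => [set u; v]%SET) x p.

(* An edge-colouring is a function on all sets of vertices, of which only the
   values on edges G are ever used; likewise for list assignments below. *)
Definition rainbow (G : sgraph) (c : {set G} -> nat) (x : G) (p : seq G) : bool :=
  uniq [seq c e | e <- path_edges x p].

Definition strongly_rainbow_connected (G : sgraph) (c : {set G} -> nat) : Prop :=
  forall x y : G, exists p : seq G, geodesic x y p /\ rainbow c x p.

Definition num_colours (G : sgraph) (c : {set G} -> nat) : nat :=
  size (undup [seq c e | e <- enum (edges G)]).

Definition is_minimum (P : nat -> Prop) (n : nat) : Prop :=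
  P n /\ forall m : nat, P m -> n <= m.

(* is_src G a stands for src(G) = a. *)
Definition is_src (G : sgraph) : nat -> Prop :=
  is_minimum (fun k => exists c : {set G} -> nat,
    strongly_rainbow_connected c /\ num_colours c = k).

(* `I_r is the set of natural numbers smaller than r, so the condition says
   that L e, which may be infinite, has at least r elements. *)
Definition edge_list_assignment (G : sgraph) (r : nat)
    (L : {set G} -> set nat) : Prop :=
  forall e : {set G}, e \in edges G -> (`I_r #<= L e)%card.

Definition list_edge_colouring (G : sgraph) (L : {set G} -> set nat)
    (c : {set G} -> nat) : Prop :=
  forall e : {set G}, e \in edges G -> L e (c e).

(* is_src_list G b stands for src^l(G) = b. *)
Definition is_src_list (G : sgraph) : nat -> Prop :=
  is_minimum (fun r => forall L : {set G} -> set nat,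
    edge_list_assignment r L ->
    exists c : {set G} -> nat,
      list_edge_colouring L c /\ strongly_rainbow_connected c).

(* Main.v *)
Require Import Defs.
From mathcomp Require Import all_boot.
From mathcomp Require Import boolp classical_sets cardinality.

(**
A colouring with one colour can only make paths of length at most one rainbow,
so src(G) = 1 forces G to be complete, and then src^l(G) = 1; and src <= src^l
because all lists may be taken equal.

For the converse, let G consist of cliques sharing exactly one vertex, the apex.
Two vertices of different cliques are joined by a unique geodesic, through the
apex, so a colouring of G is strongly rainbow connected if and only if the
spokes (the edges at the apex) to different cliques have different colours.
Hence src(G) is the number of cliques, and src^l(G) is the choice number of the
complete multipartite graph whose parts are the cliques minus the apex.  With
m = b - 1, distribute m vertices among a - 1 parts and add one part of m ^ m
vertices: colouring the m vertices first is greedy with lists of size m + 1,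
while m disjoint lists of size m on them, together with all their transversals
on the last part, admit no colouring.
*)

Set Implicit Arguments.
Unset Strict Implicit.
Unset Printing Implicit Defensive.

(** * Cardinality of lists and greedy choice of distinct colours *)

Lemma card_IIleP (n : nat) (A : set nat) :
  (`I_n #<= A)%card <->
  exists f : nat -> nat, (forall i, i < n -> A (f i)) /\
    (forall i j, i < n -> j < n -> f i = f j -> i = j).
Proof.
split=> [/pcard_leP/injfunPex[f fA finj]|[f [fA finj]]].
  by exists f; split=> // i j ltin ltjn; apply: finj; rewrite inE.
by apply/pcard_leP/injfunPex; exists f => // i j; rewrite !inE; apply: finj.
Qed.

Lemma card_II_avoid (n : nat) (A : set nat) (s : seq nat) :
  size s < n -> (`I_n #<= A)%card -> exists2 k, A k & k \notin s.
Proof.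
move=> lt_sn /card_IIleP[f [fA finj]]; apply: contrapT => nex.
have : size (map f (iota 0 n)) <= size s.
  apply: uniq_leq_size.
    rewrite map_inj_in_uniq ?iota_uniq// => i j.
    by rewrite !mem_iota !add0n => /andP[_ ?] /andP[_ ?]; apply: finj.
  move=> _ /mapP[i + ->]; rewrite mem_iota add0n => /andP[_ ltin].
  by apply: contrapT => /negP fis; apply: nex; exists (f i) => //; apply: fA.
by rewrite size_map size_iota leqNgt lt_sn.
Qed.

Lemma greedy_distinct (m : nat) (A : nat -> set nat) :
  (forall i, i < m -> (`I_m #<= A i)%card) ->
  exists s : seq nat, [/\ size s = m, uniq s & forall i, i < m -> A i (nth 0 s i)].
Proof.
(* The induction is on the number [k] of colours already chosen, while the lists keep their size
   [m]; a further colour exists as long as [k < m]. *)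
suff H k : k <= m -> (forall i, i < m -> (`I_m #<= A i)%card) ->
    exists s : seq nat, [/\ size s = k, uniq s & forall i, i < k -> A i (nth 0 s i)].
  by move=> hA; apply: H.
elim: k => [|k IH] lekm hA; first by exists [::].
have [s [szs us sA]] := IH (ltnW lekm) hA.
have [x Ax xs] : exists2 x, A k x & x \notin s.
  by apply: card_II_avoid (hA k lekm); rewrite szs.
exists (rcons s x); split; rewrite ?size_rcons ?szs ?rcons_uniq ?xs//.
move=> i; rewrite ltnS leq_eqVlt nth_rcons szs => /orP[/eqP->|ltik].
  by rewrite ltnn eqxx.
by rewrite ltik; apply: sA.
Qed.

(** * Bounds valid in every graph *)

Section Graph.
Variable G : sgraph.
Implicit Types (c : {set G} -> nat) (e : {set G}).

Lemma path_edges_sub (x : G) (p : seq G) :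
  path (@adj G) x p -> {subset path_edges x p <= edges G}.
Proof.
elim: p x => [|y p IH] x //= /andP[xy yp] e; rewrite inE => /orP[/eqP->|].
  by apply/imsetP; exists (x, y); rewrite ?inE.
exact: IH.
Qed.

Lemma leq_num_colours c (s : seq {set G}) :
  {subset s <= edges G} -> uniq [seq c e | e <- s] -> size s <= num_colours c.
Proof.
move=> sE us; rewrite -(size_map c) /num_colours; apply: uniq_leq_size => // k.
case/mapP=> e es ->; rewrite mem_undup; apply: map_f.
by rewrite mem_enum; apply: sE.
Qed.

Lemma num_colours_leq c (k : nat) :
  (forall e, e \in edges G -> c e < k) -> num_colours c <= k.
Proof.
move=> ck; rewrite -[k in _ <= k](size_iota 0); apply: uniq_leq_size.
  exact: undup_uniq.
move=> n; rewrite mem_undup => /mapP[e]; rewrite mem_enum => eE ->.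
by rewrite mem_iota add0n ck.
Qed.

Lemma src_leq_src_list (a b : nat) : is_src G a -> is_src_list G b -> a <= b.
Proof.
move=> [_ amin] [bP _].
have [|c [cb csrc]] := bP (fun=> `I_b)%classic; first by move=> e _; apply: card_lexx.
apply: leq_trans (amin _ _) (num_colours_leq cb).
by exists c.
Qed.

Lemma list_assignment_choice (r : nat) (L : {set G} -> set nat) :
  0 < r -> edge_list_assignment r L -> exists c, list_edge_colouring L c.
Proof.
move=> r0 rL.
have /choice[c cP] : forall e, exists k, e \in edges G -> L e k.
  move=> e; case: (boolP (e \in edges G)) => [eE|_]; last by exists 0.
  have [|k Lk _] := @card_II_avoid r _ [::] _ (rL e eE); first by [].
  by exists k.
by exists c.
Qed.

Lemma src1_src_list (b : nat) : is_src G 1 -> is_src_list G b -> b <= 1.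
Proof.
move=> [[c [csrc c1]] _] [_ bmin]; apply: bmin => L rL.
have [c' c'L] := list_assignment_choice (ltn0Sn 0) rL.
exists c'; split=> // x y.
(* The same geodesic serves for [c']: being rainbow in one colour, it has at most one edge, so it is
   rainbow in every colouring. *)
have [p [gp rp]] := csrc x y; exists p; split=> //.
have /and3P[xp _ _] := gp.1.
have := leq_num_colours (path_edges_sub xp) rp.
by rewrite c1 /rainbow; case: (path_edges x p) => [|e [|f s]].
Qed.

End Graph.

(** * Cliques glued at an apex *)

Section CliqueWedge.
Variables (T : finType) (cl : T -> nat).

(** [None] is the apex; each fibre of [cl] together with it is one of the cliques. *)
Definition wedge_adj (u v : option T) : bool :=
  match u, v with
  | Some x, Some y => (x != y) && (cl x == cl y)
  | None, None => false
  | _, _ => true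
  end.

Lemma wedge_adj_sym : symmetric wedge_adj.
Proof. by move=> [x|] [y|] //=; rewrite eq_sym [cl x == _]eq_sym. Qed.

Lemma wedge_adj_irr : irreflexive wedge_adj.
Proof. by move=> [x|] //=; rewrite eqxx. Qed.

Definition wedge : sgraph := SGraph wedge_adj_sym wedge_adj_irr.

Definition spoke (t : T) : {set wedge} := [set None; Some t]%SET.

Lemma spoke_edge (t : T) : spoke t \in edges wedge.
Proof. by apply/imsetP; exists (None, Some t); rewrite ?inE. Qed.

Lemma wedge_edgeP (e : {set wedge}) :
  e \in edges wedge -> (exists t, e = spoke t) \/ None \notin e.
Proof.
case/imsetP=> -[[x|] [y|]]; rewrite !inE //= => _ ->.
- by right; rewrite !inE.
- by left; exists x; rewrite /spoke finset.setUC.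
- by left; exists y.
Qed.

(** Prescribes values at the spokes and falls back on [g] elsewhere. The type [A] is left open to
    cover both colourings and list assignments. *)
Definition on_spokes (A : Type) (f : T -> A) (g : {set wedge} -> A)
    (e : {set wedge}) : A :=
  if None \in e then if [pick t | Some t \in e] is Some t then f t else g e
  else g e.

Lemma on_spokesE (A : Type) (f : T -> A) g (t : T) :
  on_spokes f g (spoke t) = f t.
Proof.
rewrite /on_spokes !inE /=; case: pickP => [u|/(_ t)]; rewrite !inE /=.
  by move/eqP=> [->].
by rewrite eqxx.
Qed.

Lemma on_spokes_out (A : Type) (f : T -> A) g (e : {set wedge}) :
  None \notin e -> on_spokes f g e = g e.
Proof. by rewrite /on_spokes => /negbTE->. Qed.

Lemma wedge_connected : connected_graph wedge.
Proof.
split; first by apply/card_gt0P; exists None.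
have toN (u : wedge) : connect (@adj wedge) u None.
  by case: u => [x|]; [apply: connect1|apply: connect0].
have fromN (u : wedge) : connect (@adj wedge) None u.
  by case: u => [x|]; [apply: connect1|apply: connect0].
by move=> x y; apply: connect_trans (toN x) (fromN y).
Qed.

Lemma wedge_srcP (c : {set wedge} -> nat) :
  strongly_rainbow_connected c <->
  forall x y, cl x != cl y -> c (spoke x) != c (spoke y).
Proof.
split=> [csrc x y clxy|H].
  have [p [[/and3P[xp lastp _] pmin] rp]] := csrc (Some x) (Some y).
  have neqxy : x != y by apply: contra_neq clxy => ->.
  have : size p <= 2.
    apply: (pmin [:: None; Some y]).
    by rewrite /is_path /= eqxx !inE (inj_eq Some_inj) neqxy.
  move: lastp xp rp; case: p {pmin} => [|u [|v [|w p]]] //=.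
  - by move/eqP=> [] /eqP; rewrite (negbTE neqxy).
  - by move/eqP-> => /=; rewrite (negbTE clxy) andbF.
  - move/eqP->; case: u => [z|] /=; last first.
      move=> _; rewrite /rainbow /= inE andbT => + _.
      by rewrite /spoke [[set Some x; None]%SET]finset.setUC.
    by move=> /and3P[/andP[_ /eqP e1] /andP[_ /eqP e2] _]; rewrite e1 e2 eqxx in clxy.
move=> u v; case: (eqVneq u v) => [<-|nuv].
  by exists [::]; split=> //; split=> //; rewrite /is_path /= eqxx.
case: (boolP (wedge_adj u v)) => [auv|nauv].
  exists [:: v]; split=> //; split.
    by rewrite /is_path /= auv eqxx inE nuv.
  by case=> [|w q] //; rewrite /is_path /= (negbTE nuv).
case: u v nuv nauv => [x|] [y|] //= nxy nauv.
have {}nauv : cl x != cl y.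
  by move: nauv; rewrite negb_and negbK -(inj_eq Some_inj) (negbTE nxy).
exists [:: None; Some y]; split; last first.
  by rewrite /rainbow /= inE andbT [[set Some x; None]%SET]finset.setUC; apply: H.
split; first by rewrite /is_path /= eqxx !inE nxy.
case=> [|w [|w' q]] //; rewrite /is_path /= ?(negbTE nxy) //.
by case: eqP => [->|]; rewrite /= ?(negbTE nauv) ?andbF.
Qed.

Lemma wedge_src (a : nat) (r : 'I_a -> T) :
  0 < a -> (forall t, cl t < a) -> (forall i, cl (r i) = i) -> is_src wedge a.
Proof.
move=> a_gt0 cla clr.
have low (c : {set wedge} -> nat) : strongly_rainbow_connected c -> a <= num_colours c.
  move=> /wedge_srcP csrc.
  have := @leq_num_colours wedge c [seq spoke (r i) | i <- enum 'I_a].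
  rewrite size_map size_enum_ord; apply.
    by move=> _ /mapP[i _ ->]; apply: spoke_edge.
  rewrite -map_comp map_inj_uniq ?enum_uniq// => i j /= eqc.
  apply/eqP; apply: contraT => nij; have := csrc (r i) (r j).
  by rewrite !clr eqc eqxx => /(_ nij).
split=> [|m [c [csrc <-]]]; last exact: low.
(* Each spoke is coloured by its clique. The remaining edges get 0, which is not a new colour
   because [0 < a]. *)
pose c := on_spokes cl (fun=> 0).
have csrc : strongly_rainbow_connected c.
  by apply/wedge_srcP => x y; rewrite /c !on_spokesE.
exists c; split=> //; apply/eqP; rewrite eqn_leq low// andbT.
apply: num_colours_leq => e /wedge_edgeP[[t ->]|Ne]; rewrite /c.
  by rewrite on_spokesE.
by rewrite on_spokes_out.
Qed.

End CliqueWedge.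

(** * The wedge realising a given pair of values *)

Section Construction.
Variables a m : nat.

(** A function [f] encodes the transversal taking the [f i]-th colour of list [i]. The cap [a.-2]
    sends surplus vertices to the last of the first [a - 1] parts, all of which are hit by [le_am].
    If [a = 1] there are no such parts, whence [a1]. *)
Definition part_of (t : 'I_m + {ffun 'I_m -> 'I_m}) : nat :=
  if t is inl i then minn i a.-2 else a.-1.

Hypotheses (a_gt0 : 0 < a) (le_am : a <= m.+1) (a1 : a = 1 -> m = 0).

Lemma part_of_neq (i : 'I_m) f : part_of (inl i) != part_of (inr f).
Proof.
rewrite /part_of; case: a a_gt0 a1 => [|[|n]] // _ a1' /=.
  by have := ltn_ord i; rewrite [X in _ < X]a1'.
by rewrite neq_ltn ltnS geq_minr.
Qed.

Lemma part_of_src : is_src (wedge part_of) a.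
Proof.
have /choice[r rP] : forall i : 'I_a, exists t, part_of t = i.
  move=> [i /= ltia]; case: (ltnP i a.-1) => [lti|gei]; last first.
    (* The identity is a convenient element of the last part, available even for [m = 0]. *)
    exists (inr [ffun i => i]); apply/eqP => /=.
    by rewrite eqn_leq gei -ltnS prednK.
  have ltim : i < m by apply: leq_trans lti _; rewrite -ltnS prednK.
  exists (inl (Ordinal ltim)) => /=; apply/minn_idPl.
  by case: a lti => [|[]].
apply: (wedge_src a_gt0) rP; case=> [i|f] /=; last by rewrite prednK.
by apply: leq_ltn_trans (geq_minr _ _) _; case: a a_gt0 => [|[]].
Qed.

Lemma part_of_list_colouring (L : {set wedge part_of} -> set nat) :
  edge_list_assignment m.+1 L ->
  exists c, list_edge_colouring L c /\ strongly_rainbow_connected c.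
Proof.
move=> rL; have [h hL] := list_assignment_choice (ltn0Sn m) rL.
have rLs t : (`I_m.+1 #<= L (spoke part_of t))%card by apply/rL/spoke_edge.
(* The value [setT] is a filler for indices outside ['I_m]. *)
pose A i : set nat := if insub i is Some j then L (spoke part_of (inl j)) else setT.
have [s [szs us sA]] : exists s : seq nat,
    [/\ size s = m, uniq s & forall i, i < m -> A i (nth 0 s i)].
  apply: greedy_distinct => i ltim; rewrite /A insubT.
  by apply: card_le_trans (rLs _); rewrite card_le_II.
have /choice[g gP] : forall f, exists k, L (spoke part_of (inr f)) k /\ k \notin s.
  move=> f; have [|k] := card_II_avoid (s := s) _ (rLs (inr f)); first by rewrite szs.
  by exists k.
pose k (t : 'I_m + {ffun 'I_m -> 'I_m}) :=
  match t with inl i => nth 0 s i | inr f => g f end.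
have kL t : L (spoke part_of t) (k t).
  case: t => [i|f] /=; last by case: (gP f).
  by have := sA i (ltn_ord i); rewrite /A valK.
exists (on_spokes k h); split.
  move=> e eE; case: (wedge_edgeP eE) => [[t ->]|Ne].
    by rewrite on_spokesE.
  by rewrite on_spokes_out //; apply: hL.
have sg (i : 'I_m) f : nth 0 s i != g f.
  by apply: contraNneq (gP f).2 => <-; rewrite mem_nth ?szs.
apply/wedge_srcP => x y; rewrite !on_spokesE.
case: x y => [i|f] [j|f'] //=.
- by apply: contra_neq => /eqP; rewrite nth_uniq ?szs // => /eqP->.
- by rewrite [g f == _]eq_sym.
- by rewrite eqxx.
Qed.

Lemma transversal_lists_uncolourable (r : nat) : r <= m ->
  exists2 L : {set wedge part_of} -> set nat, edge_list_assignment r L &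
    forall c, list_edge_colouring L c -> ~ strongly_rainbow_connected c.
Proof.
move=> lerm.
(* The disjoint lists are the blocks of [m] consecutive numbers starting at [i * m]; the list of [f]
   has one element in each block. *)
pose L0 (t : 'I_m + {ffun 'I_m -> 'I_m}) : set nat :=
  match t with
  | inl i => fun n => exists j : 'I_m, n = i * m + j
  | inr f => fun n => exists i : 'I_m, n = i * m + f i
  end.
exists (on_spokes L0 (fun=> setT)) => [e eE|c cL /wedge_srcP csrc].
  apply: card_le_trans (_ : (`I_m #<= _)%card); first by rewrite card_le_II.
  case: (wedge_edgeP eE) => [[t ->]|Ne]; last first.
    rewrite on_spokes_out//; apply: subset_card_le; exact: subsetT.
  rewrite on_spokesE; apply/card_IIleP; case: t => [i|f].
    exists (fun j => i * m + j); split=> [j ltjm|j j' _ _ /addnI//].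
    by exists (Ordinal ltjm).
  exists (fun i => i * m + oapp (fun j => f j : nat) 0 (insub i)).
  split=> [i ltim|i j ltim ltjm].
    by exists (Ordinal ltim); rewrite insubT.
  (* Division by [m] recovers the block, so the elements of a transversal are distinct. *)
  rewrite !insubT /= => /(congr1 (divn^~ m)).
  by rewrite !divnMDl ?(leq_ltn_trans _ ltim)// !divn_small// !addn0.
have cL0 t : L0 t (c (spoke part_of t)).
  by have := cL _ (spoke_edge part_of t); rewrite on_spokesE.
(* The colours chosen on the blocks form a transversal [j]. Any colour from its list is already used
   at some [inl i], in another part. *)
have /choice[j jP] := fun i => cL0 (inl i).
have [i ci] := cL0 (inr [ffun i => j i]).
have := csrc _ _ (part_of_neq i [ffun i => j i]).
by rewrite ci jP ffunE eqxx.
Qed.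

Lemma part_of_src_list : is_src_list (wedge part_of) m.+1.
Proof.
split=> [|r rP]; first exact: part_of_list_colouring.
rewrite ltnNge; apply/negP => /transversal_lists_uncolourable[L rL nL].
by have [c [cL]] := rP L rL; apply: nL.
Qed.

End Construction.

Theorem theorem4p2 (a b : nat) (ha : 0 < a) (hb : 0 < b) :
  (exists G : sgraph, [/\ connected_graph G, is_src G a & is_src_list G b])
  <-> (a = 1 /\ b = 1) \/ (2 <= a /\ a <= b).
Proof.
split=> [[G [_ srca srcb]]|ab].
  have leab := src_leq_src_list srca srcb.
  case: a ha srca leab => [|[|a]] // _ srca leab; last by right.
  by left; split=> //; apply/eqP; rewrite eqn_leq hb andbT; apply: src1_src_list srcb.
have [le_ab a1] : a <= b.-1.+1 /\ (a = 1 -> b.-1 = 0).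
  by rewrite prednK//; case: ab => [[-> ->]|[a2 ->]] //; split=> // a1; rewrite a1 in a2.
exists (wedge (@part_of a b.-1)); split; first exact: wedge_connected.
  exact: part_of_src.
by rewrite -[b in is_src_list _ b](prednK hb); apply: part_of_src_list.
Qed.
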